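(* Greedy Approval Voting (GAV) satisfies simple justified representation.
   Context: Attribute-approval committee selection: there is a set of voters $V=\{v_1,\dots,v_n\}$, a set of candidates $C=\{c_1,\dots,c_m\}$, a number of dimensions $d$, and a target committee size $k$. Each candidate $c$ has a $d$-dimensional vector of attribute values $(c[1],\dots,c[d])$, with $c[j]$ from a domain $D^j$. Each voter $v_i$ submits, for every $j\in\{1,\dots,d\}$, the set $C_i^j\subseteq D^j$ of values that $v_i$ approves. A committee is a set $W\subseteq C$ of $k$ candidates, and $W^j$ denotes the set of attributes of $W$ on dimension $j$. For a set of voters $U\subseteq V$ put $U_{c[j]}=\{v_i\in U: c[j]\in C_i^j\}$. Greedy Approval Voting (GAV): start with $W=\emptyset$ and $V'=V$. While $|W|<k$: choose $c_*\in C\setminus W$ maximizing $\max_{1\le j\le d}|V'_{c_*[j]}|$; add $c_*$ to $W$; replace $V'$ by $V'\setminus\bigcup_{j=1}^d V_{c_*[j]}$; if $V'$ is now empty, reset $V'=V$. Output $W$. Simple justified representation (SJR) of a committee $W$: for every $U\subseteq V$ with $|U|\ge \frac nk$ such that $\bigcap_{v_i\in U}C_i^j\neq\emptyset$ for some $j\in\{1,\dots,d\}$, there is $j'\in\{1,\dots,d\}$ with $\left(\bigcup_{v_i\in U}C_i^{j'}\right)\cap W^{j'}\ne\emptyset$. A rule satisfies SJR if the committee it selects always satisfies it.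
   Formalization: The formal statement assumes that every attribute value approved by a voter is held by at least one candidate; without this the claim fails, e.g. when all voters approve only a value that no candidate has. *)

(* Defs.v *)
(* MathComp *)
From mathcomp Require Import all_boot all_order all_algebra.

Set Implicit Arguments.
Unset Strict Implicit.
Unset Printing Implicit Defensive.

(* The domains [dom j] are arbitrary types and may contain values that no
   candidate has. [approved v j] is the set C_v^j of the values on dimension j
   that voter v approves. *)
Record election := Election {
  voter : finType;
  cand : finType;
  ndim : nat;
  dom : 'I_ndim -> Type;
  attr : cand -> forall j : 'I_ndim, dom j;
  approved : voter -> forall j : 'I_ndim, {pred dom j}
}.

Arguments attr {e} c j.
Arguments approved {e} v j.

Section AttributeApproval.
Variable E : election.

(* U_{c[j]} *)
Definition supporters (U : {set voter E}) (c : cand E) (j : 'I_(ndim E)) :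
    {set voter E} :=
  [set v in U | attr c j \in approved v j].

Definition score (U : {set voter E}) (c : cand E) : nat :=
  \max_(j < ndim E) #|supporters U c j|.

Definition satisfied (c : cand E) : {set voter E} :=
  \bigcup_(j < ndim E) supporters [set: voter E] c j.

Definition reset_if_empty (U : {set voter E}) : {set voter E} :=
  if U == set0 then [set: voter E] else U.

(* [gav_state k W V'] : under some tie-breaking, GAV with target size k goes
   through the state with partial committee W and remaining voters V'. *)
Inductive gav_state (k : nat) : {set cand E} -> {set voter E} -> Prop :=
| gav_start : gav_state k set0 [set: voter E]
| gav_step (W : {set cand E}) (V' : {set voter E}) (c : cand E) :
    gav_state k W V' ->
    #|W| < k ->
    c \notin W ->
    (forall c' : cand E, c' \notin W -> score V' c' <= score V' c) ->
    gav_state k (c |: W) (reset_if_empty (V' :\: satisfied c)).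

(* Ties are broken arbitrarily, so GAV is a relation: W is a possible output. *)
Definition gav (k : nat) (W : {set cand E}) : Prop :=
  exists2 V' : {set voter E}, gav_state k W V' & ~~ (#|W| < k).

Definition common_approval (U : {set voter E}) (j : 'I_(ndim E)) : Prop :=
  exists x : dom j, forall v : voter E, v \in U -> x \in approved v j.

(* The union of the C_v^j over v in U meets W^j = {c[j] : c in W}. *)
Definition represented (W : {set cand E}) (U : {set voter E})
    (j : 'I_(ndim E)) : Prop :=
  exists x : dom j,
    (exists2 v : voter E, v \in U & x \in approved v j) /\
    (exists2 c : cand E, c \in W & attr c j = x).

Definition sjr (k : nat) (W : {set cand E}) : Prop :=
  forall U : {set voter E},
    (#|voter E|%:R / k%:R <= #|U|%:R :> rat)%R ->
    (exists j : 'I_(ndim E), common_approval U j) ->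
    exists j' : 'I_(ndim E), represented W U j'.

(* GAV always produces a committee of the target size. *)
Lemma gav_card k W : gav k W -> #|W| = k.
Proof.
case=> V' st; rewrite -leqNgt => kW; apply/eqP; rewrite eqn_leq kW andbT.
by case: st {kW} => [|{}W {}V' c _ Wk cW _]; rewrite ?cards0 // cardsU1 cW.
Qed.

Lemma gav_exists k : k <= #|cand E| -> exists W, gav k W.
Proof.
move=> kC.
have run i : i <= k -> exists W V', gav_state k W V' /\ #|W| = i.
  elim: i => [|i IHi] ik.
    by exists set0, setT; split; [exact: gav_start | rewrite cards0].
  have [W [V' [st cW]]] := IHi (ltnW ik).
  have /set0Pn[c0] : ~: W != set0.
    by rewrite -card_gt0 cardsCs setCK cW subn_gt0 (leq_trans ik).
  rewrite inE => c0W.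
  case: (@arg_maxnP _ c0 (fun c => c \notin W) (score V') c0W) => c cW' cmax.
  exists (c |: W), (reset_if_empty (V' :\: satisfied c)); split.
    by apply: gav_step => //; rewrite cW.
  by rewrite cardsU1 cW' cW.
have [W [V' [st cW]]] := run k (leqnn k).
by exists W, V'; rewrite // cW ltnn.
Qed.

End AttributeApproval.

(* Main.v *)
(* If U is not represented, no chosen candidate satisfies a voter of U, so U
   stays inside V' and, being nonempty, prevents any reset. The value that U
   approves unanimously belongs to an unchosen candidate of score at least #|U|,
   so each of the k rounds deletes at least #|U| >= n / k voters from V'. The
   k rounds thus delete all voters, although those in U are never deleted. *)
Require Import Defs.
From mathcomp Require Import all_boot all_order all_algebra.

Import GRing.Theory Num.Theory.

Lemma card_supporters_le_score {E : election} (U : {set voter E}) (c : cand E)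
    (j : 'I_(ndim E)) :
  #|supporters U c j| <= score U c.
Proof. exact: (leq_bigmax (F := fun i => #|supporters U c i|) j). Qed.

(** A score counts the voters won on one dimension, while [satisfied] collects them over all
    dimensions. *)
Lemma score_le_satisfied {E : election} (U : {set voter E}) (c : cand E) :
  score U c <= #|U :&: satisfied c|.
Proof.
apply/bigmax_leqP => j _; apply/subset_leq_card/subsetP => v.
rewrite !inE => /andP[-> vcj] /=.
by apply/bigcupP; exists j; rewrite // !inE.
Qed.

(** Loop invariant, by induction on the run; the bound on [#|V'|] survives because no reset
    occurs. *)
Lemma gav_state_unrepresented {E : election} (k : nat) (U : {set voter E})
    (c0 : cand E) (j0 : 'I_(ndim E)) (W : {set cand E}) (V' : {set voter E}) :
  U != set0 ->
  (forall v, v \in U -> attr c0 j0 \in approved v j0) ->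
  gav_state k W V' ->
  (forall j, ~ represented W U j) ->
  U \subset V' /\ #|V'| + #|W| * #|U| <= #|voter E|.
Proof.
move=> U_neq0 Uc0; elim=> [|{}W {}V' c _ IH _ cW c_max] nrep.
  by rewrite subsetT cards0 mul0n addn0 cardsT.
(* The first branch is the premise of [IH]: whatever represents [U] in [W] also does so in
   [c |: W]. *)
have [j [x [xU [c' c'W c'x]]]|UV' cardV'] := IH.
  by apply: (nrep j); exists x; split=> //; exists c'; rewrite // inE c'W orbT.
have c0W : c0 \notin W.
  apply/negP => c0W; have /set0Pn[v vU] := U_neq0.
  apply: (nrep j0); exists (attr c0 j0); split; first by exists v; rewrite ?Uc0.
  by exists c0; rewrite // inE c0W orbT.
have U_score : #|U| <= score V' c.
  apply: leq_trans (c_max _ c0W).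
  apply: leq_trans (card_supporters_le_score V' c0 j0).
  apply/subset_leq_card/subsetP => v vU.
  by rewrite inE (subsetP UV') // Uc0.
have UV'c : U \subset V' :\: satisfied c.
  apply/subsetP => v vU; rewrite inE (subsetP UV') // andbT.
  apply/negP => /bigcupP[j _]; rewrite !inE /= => vcj.
  apply: (nrep j); exists (attr c j); split; first by exists v.
  by exists c; rewrite // setU11.
have no_reset : V' :\: satisfied c != set0.
  by apply: contraNneq U_neq0 => V'0; rewrite -subset0 -V'0.
rewrite /reset_if_empty (negPf no_reset); split=> //.
apply: leq_trans cardV'.
(* The new member accounts for the deleted voters [V' :&: satisfied c], at least [#|U|] of them. *)
rewrite cardsU1 cW mulnDl mul1n addnA leq_add2r -(cardsID (satisfied c) V').
by rewrite addnC leq_add2r (leq_trans U_score) // score_le_satisfied.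
Qed.

Theorem lemma11 (E : election) (k : nat)
    (voters_nonempty : 0 < #|voter E|)
    (k_gt0 : 0 < k) (k_le_m : k <= #|cand E|)
    (approved_attained : forall (v : voter E) (j : 'I_(ndim E)) (x : dom j),
        x \in approved v j -> exists c : cand E, attr c j = x)
    (W : {set cand E}) :
  gav k W -> sjr k W.
Proof.
move=> gavW U; have cardW := gav_card gavW; case: gavW => V' stW _.
rewrite ler_pdivrMr ?ltr0n // -natrM ler_nat => U_large [j0 [x Ux]].
have U_gt0 : 0 < #|U|.
  by have := leq_trans voters_nonempty U_large; rewrite muln_gt0 => /andP[].
have U_neq0 : U != set0 by rewrite -card_gt0.
have /set0Pn[v0 v0U] := U_neq0.
have [c0 c0x] := approved_attained _ _ _ (Ux _ v0U); subst x.
(* Values lie in arbitrary types, so representation is decided by searching the finite types of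
   voters and candidates. *)
have [/existsP[j /existsP[v /existsP[c /and3P[vU cW vcj]]]]|nrep] :=
    boolP [exists j : 'I_(ndim E), exists v : voter E, exists c : cand E,
      [&& v \in U, c \in W & attr c j \in approved v j]].
  by exists j, (attr c j); split; [exists v | exists c].
have [j [x [[v vU vx] [c cW cx]]]|UV'] :=
    gav_state_unrepresented _ _ _ _ _ _ U_neq0 Ux stW.
  move: nrep => /existsP[]; exists j; apply/existsP; exists v.
  by apply/existsP; exists c; rewrite vU cW cx.
(* Here [#|V'| + #|U| * k <= #|voter E| <= #|U| * k] would leave [V'] empty, although it contains
   [U]. *)
rewrite cardW mulnC => /leq_trans/(_ U_large).
by rewrite -[leqRHS]add0n leq_add2r leqNgt (leq_trans U_gt0 (subset_leq_card UV')).
Qed.
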